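(* Let $N\ge 1$, $D\subseteq\mathbb{R}^N$, and let $\theta:D\to\mathbb{R}$ be continuous and strongly semialgebraic. Then $\theta$ is computable in the sense of Type-2 Theory of Effectivity: there is a recursive operator $T$ mapping unary partial functions on $\mathbb{N}$ to unary partial functions on $\mathbb{N}$ such that whenever $f$ is a Cauchy name of a point $\xi\in D$, $T(f)$ is a Cauchy name of $\theta(\xi)$.
   Context: A real function $\theta:D\to\mathbb{R}$, $D\subseteq\mathbb{R}^N$, is strongly semialgebraic if it is definable without parameters in the ordered field $\mathbb{R}$; equivalently, its graph $\{(\xi_1,\dots,\xi_N,\theta(\xi_1,\dots,\xi_N))\}\subseteq\mathbb{R}^{N+1}$ is definable by a Boolean combination of polynomial inequalities with integer coefficients. Continuity refers to $D$ with the subspace topology. Cauchy names are taken with respect to the standard rational notations: fix a standard surjective computable numbering $\alpha$ of $\mathbb{Q}^N$ (e.g. $\alpha(i)=\left(\frac{\rho_1(i)-\sigma_1(i)}{\tau_1(i)+1},\dots,\frac{\rho_N(i)-\sigma_N(i)}{\tau_N(i)+1}\right)$ with recursive $\rho_k,\sigma_k,\tau_k$) and similarly $\beta$ of $\mathbb{Q}$; on $\mathbb{R}^N$ use the metric $d(\xi,\xi')=\max_k|\xi_k-\xi'_k|$ and on $\mathbb{R}$ the metric $|\eta-\eta'|$. A Cauchy name of $\xi\in\mathbb{R}^N$ is a total $f:\mathbb{N}\to\mathbb{N}$ with $f(i)\in\mathrm{dom}(\alpha)$, $d(\alpha(f(i)),\alpha(f(k)))\le 2^{-i}$ for $i<k$,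 and $\alpha(f(i))\to\xi$; analogously for $\mathbb{R}$ with $\beta$. *)

(* Defs.v *)
From HB Require Import structures.
From mathcomp Require Import all_boot all_order all_algebra.
From mathcomp Require Import all_classical all_reals all_analysis.
From mathcomp Require Import ordered_qelim.

Set Implicit Arguments.
Unset Strict Implicit.
Unset Printing Implicit Defensive.

Import Order.TTheory GRing.Theory Num.Theory.
Import numFieldNormedType.Exports.

Local Open Scope classical_set_scope.
Local Open Scope ring_scope.

Section PartialRecursive.
Local Open Scope nat_scope.

Fixpoint primrec_graph (n : nat) (g : n.-tuple nat -> nat -> Prop)
    (h : n.+2.-tuple nat -> nat -> Prop) (k : nat) (x : n.-tuple nat)
    (y : nat) : Prop :=
  match k with
  | 0 => g x y
  | k'.+1 => exists2 z, primrec_graph g h k' x z & h [tuple of k' :: z :: x] y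
  end.

(* An n-ary partial function is represented by its graph. *)
Inductive partial_recursive :
    forall n : nat, (n.-tuple nat -> nat -> Prop) -> Prop :=
| pr_zero n : partial_recursive (fun (_ : n.-tuple nat) y => y = 0)
| pr_succ : partial_recursive (fun (x : 1.-tuple nat) y => y = (thead x).+1)
| pr_proj n (i : 'I_n) :
    partial_recursive (fun (x : n.-tuple nat) y => y = tnth x i)
| pr_comp m n (g : m.-tuple nat -> nat -> Prop)
    (h : 'I_m -> n.-tuple nat -> nat -> Prop) :
    partial_recursive g -> (forall i, partial_recursive (h i)) ->
    partial_recursive (fun (x : n.-tuple nat) y =>
      exists2 z : m.-tuple nat, forall i, h i x (tnth z i) & g z y)
| pr_primrec n (g : n.-tuple nat -> nat -> Prop)
    (h : n.+2.-tuple nat -> nat -> Prop) :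
    partial_recursive g -> partial_recursive h ->
    partial_recursive (fun x : n.+1.-tuple nat =>
      primrec_graph g h (thead x) [tuple of behead x])
| pr_min n (g : n.+1.-tuple nat -> nat -> Prop) :
    partial_recursive g ->
    partial_recursive (fun (x : n.-tuple nat) y =>
      g [tuple of y :: x] 0 /\
      forall z, z < y -> exists v, g [tuple of z :: x] v.+1)
| pr_ext n (g h : n.-tuple nat -> nat -> Prop) :
    (forall x y, g x y <-> h x y) ->
    partial_recursive g -> partial_recursive h.

Definition recursive (f : nat -> nat) : Prop :=
  partial_recursive (fun (x : 1.-tuple nat) y => y = f (thead x)).

Definition recursively_enumerable (n : nat) (W : n.-tuple nat -> Prop) : Prop :=
  exists g : n.-tuple nat -> nat -> Prop,
    partial_recursive g /\ forall x, W x <-> exists y, g x y.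

Definition cantor_pair (a b : nat) : nat := ((a + b) * (a + b).+1)./2 + a.

(* [canonical_set u] is the u-th finite set in the canonical indexing, whose
   elements are the positions of the digits 1 in the binary expansion of u. *)
Definition canonical_set (u : nat) : set nat := [set k | odd (u %/ 2 ^ k)].

Definition pfun := nat -> option nat.

Definition graph_code (f : pfun) : set nat :=
  [set c | exists a b, c = cantor_pair a b /\ f a = Some b].

(* Recursive operators in the sense of Rogers: enumeration operators that map
   every partial function to a partial function (which is enforced here by the
   type of T). *)
Definition recursive_operator (T : pfun -> pfun) : Prop :=
  exists W : 3.-tuple nat -> Prop,
    recursively_enumerable W /\
    forall (f : pfun) (x y : nat),
      T f x = Some y <->
      exists u, W [tuple x; y; u] /\ canonical_set u `<=` graph_code f.

End PartialRecursive.

Definition num_rat (r s t : nat -> nat) (i : nat) : rat :=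
  ((r i)%:R - (s i)%:R) / (t i).+1%:R.

(* Numberings are total, so every natural number is in their domain. *)
Definition standard_numbering_rat (beta : nat -> rat) : Prop :=
  (exists r s t : nat -> nat,
     [/\ recursive r, recursive s & recursive t] /\
     forall i, beta i = num_rat r s t i) /\
  forall q, exists i, beta i = q.

Definition standard_numbering_rV (N : nat) (alpha : nat -> 'rV[rat]_N) : Prop :=
  (exists r s t : 'I_N -> nat -> nat,
     (forall k, [/\ recursive (r k), recursive (s k) & recursive (t k)]) /\
     forall i, alpha i = \row_k num_rat (r k) (s k) (t k) i) /\
  forall q, exists i, alpha i = q.

Section Reals.
Variable R : realType.

Definition max_dist (N : nat) (x y : 'rV[R]_N) : R :=
  \big[Num.max/0]_(k < N) `|x ord0 k - y ord0 k|.

Definition abs_dist (x y : R) : R := `|x - y|.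

Definition cauchy_name (X : Type) (d : X -> X -> R) (nu : nat -> X) (x : X)
    (F : pfun) : Prop :=
  exists f : nat -> nat,
    [/\ forall i, F i = Some (f i),
        forall i k, (i < k)%N -> d (nu (f i)) (nu (f k)) <= 2 ^- i
      & (fun i => d (nu (f i)) x) @ \oo --> (0 : R)].

Definition real_numbering_rV (N : nat) (alpha : nat -> 'rV[rat]_N) (i : nat) :
  'rV[R]_N := map_mx ratr (alpha i).

Definition real_numbering (beta : nat -> rat) (i : nat) : R := ratr (beta i).

Fixpoint param_free_term (t : GRing.term R) : bool :=
  match t with
  | GRing.Var _ | GRing.NatConst _ => true
  | GRing.Const _ => false
  | GRing.Opp t1 | GRing.NatMul t1 _ | GRing.Inv t1 | GRing.Exp t1 _ =>
      param_free_term t1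
  | GRing.Add t1 t2 | GRing.Mul t1 t2 =>
      param_free_term t1 && param_free_term t2
  end.

Fixpoint param_free (phi : ord.formula R) : bool :=
  match phi with
  | ord.Bool _ => true
  | ord.Equal t1 t2 | ord.Lt t1 t2 | ord.Le t1 t2 =>
      param_free_term t1 && param_free_term t2
  | ord.Unit t1 => param_free_term t1
  | ord.And p q | ord.Or p q | ord.Implies p q => param_free p && param_free q
  | ord.Not p | ord.Exists _ p | ord.Forall _ p => param_free p
  end.

(* A function D -> R is given by a total function theta, of which only the
   values on D matter. [ord.rformula] restricts phi to the signature of ordered
   rings; the variables 'X_0, ..., 'X_(N-1) stand for the coordinates of x and
   'X_N stands for y. *)
Definition strongly_semialgebraic (N : nat) (D : set 'rV[R]_N)
    (theta : 'rV[R]_N -> R) : Prop :=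
  exists phi : ord.formula R,
    [/\ ord.rformula phi, param_free phi
      & forall (x : 'rV[R]_N) (y : R),
          ord.holds (rcons [seq x ord0 k | k <- enum 'I_N] y) phi <->
          D x /\ y = theta x].

End Reals.

(* Main.v *)
Require Import Defs.
From HB Require Import structures.
From mathcomp Require Import all_boot all_order all_algebra.
From mathcomp Require Import all_classical all_reals all_analysis.
From mathcomp Require Import ordered_qelim.
From mathcomp Require qe_rcf qe_rcf_th.
From mathcomp Require Import ring lra zify.

(** Continuity at a point [xi] of [D] gives, for every [x], a ball around [xi]
    on which [theta] stays within [2^-(x+1)] of a rational [q]. Given a Cauchy
    name [f] of [xi], one therefore searches for [k] and [q] such that
    [|theta z - q| <= 2^-(x+1)] for all [z] in [D] at distance at most [2^-k]
    from the rational point named by [f k]; as [xi] itself is such a [z], every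
    [q] that is found is good. This condition on the rational data is
    first-order over the ordered field [R], so by quantifier elimination it is
    equivalent to a quantifier-free formula, in which only rational constants
    occur; such a formula is decidable at rational arguments. To be
    single-valued on every partial function, the search tries at stage [k] only
    the outputs with index at most [k], and it stops at the first successful
    stage. *)

Set Implicit Arguments.
Unset Strict Implicit.
Unset Printing Implicit Defensive.

Import Order.TTheory GRing.Theory Num.Theory.
Import numFieldNormedType.Exports.
(* The equality on terms is declared inside the module [ord]. *)
Import (canonicals) ord.

Local Open Scope classical_set_scope.
Local Open Scope ring_scope.

(** * Rationality of the constants in quantifier elimination *)

Section RationalConstants.
Variable F : rcfType.

(** A classical truth value in [bool] lets the syntactic predicates below combine with [&&] and
    [all]. Integers would be too narrow: the elimination uses entries of inverses of integer
    matrices. *)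
Definition rational (c : F) : bool := `[< exists q : rat, c = ratr q >].

Lemma rational_ratr q : rational (ratr q).
Proof. by apply/asboolP; exists q. Qed.

Lemma rational_nat n : rational n%:R.
Proof. by rewrite -(ratr_nat F); apply: rational_ratr. Qed.

Lemma rational_int (z : int) : rational z%:~R.
Proof. by rewrite -ratr_int; apply: rational_ratr. Qed.

Lemma rational0 : rational 0.
Proof. exact: (rational_nat 0). Qed.

Fixpoint rat_term (t : GRing.term F) : bool :=
  match t with
  | GRing.Var _ | GRing.NatConst _ => true
  | GRing.Const c => rational c
  | GRing.Opp t1 | GRing.NatMul t1 _ | GRing.Inv t1 | GRing.Exp t1 _ =>
      rat_term t1
  | GRing.Add t1 t2 | GRing.Mul t1 t2 => rat_term t1 && rat_term t2
  end.

Fixpoint rat_form (f : ord.formula F) : bool :=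
  match f with
  | ord.Bool _ => true
  | ord.Equal t1 t2 | ord.Lt t1 t2 | ord.Le t1 t2 =>
      rat_term t1 && rat_term t2
  | ord.Unit t1 => rat_term t1
  | ord.And p q | ord.Or p q | ord.Implies p q => rat_form p && rat_form q
  | ord.Not p | ord.Exists _ p | ord.Forall _ p => rat_form p
  end.

(* [qe_rcf] has its own syntax for quantifier-free terms and formulas. *)
Fixpoint rat_qterm (t : qe_rcf.term F) : bool :=
  match t with
  | qe_rcf.Var _ | qe_rcf.NatConst _ => true
  | qe_rcf.Const c => rational c
  | qe_rcf.Opp t1 | qe_rcf.NatMul t1 _ | qe_rcf.Exp t1 _ => rat_qterm t1
  | qe_rcf.Add t1 t2 | qe_rcf.Mul t1 t2 => rat_qterm t1 && rat_qterm t2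
  end.

Fixpoint rat_qform (f : qe_rcf.formula F) : bool :=
  match f with
  | qe_rcf.Bool _ => true
  | qe_rcf.Equal t1 t2 | qe_rcf.Lt t1 t2 | qe_rcf.Le t1 t2 =>
      rat_qterm t1 && rat_qterm t2
  | qe_rcf.And p q | qe_rcf.Or p q | qe_rcf.Implies p q =>
      rat_qform p && rat_qform q
  | qe_rcf.Not p => rat_qform p
  end.

Local Notation rat_qpoly := (all rat_qterm).
Local Notation preserves P k := (forall x, P x -> rat_qform (k x)).

Lemma rat_rterm_to_term t : rat_term (qe_rcf.rterm_to_term t) = rat_qterm t.
Proof. by elim: t => //= t1 -> t2 ->. Qed.

Lemma rat_qfr_to_formula f : rat_form (qe_rcf.qfr_to_formula f) = rat_qform f.
Proof.
by elim: f => //= [t1 t2|t1 t2|t1 t2|f -> g ->|f -> g ->|f -> g ->] //;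
  rewrite !rat_rterm_to_term.
Qed.

Lemma rat_to_rterm t : rat_term t -> rat_qterm (qe_rcf.to_rterm t).
Proof. by elim: t => //= t1 IH1 t2 IH2 /andP[/IH1-> /IH2->]. Qed.

(* [qe_rcf] builds formulas in continuation-passing style: the argument [k] of
   its functions is the rest of the construction. *)
Lemma rat_Size p k : rat_qpoly p -> (forall n, rat_qform (k n)) ->
  rat_qform (qe_rcf.Size p k).
Proof.
elim: p k => [|c p IHp] k //= /andP[rc rp] rk.
apply: IHp => // -[|n] //=; by rewrite rc !rk.
Qed.

Lemma rat_Isnull p k : rat_qpoly p -> (forall b, rat_qform (k b)) ->
  rat_qform (qe_rcf.Isnull p k).
Proof. by move=> rp rk; apply: rat_Size. Qed.

Lemma rat_LeadCoef p k : rat_qpoly p -> preserves rat_qterm k ->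
  rat_qform (qe_rcf.LeadCoef p k).
Proof.
elim: p k => [|c p IHp] k /=; first by move=> _ ->//; apply: rational0.
by move=> /andP[rc rp] rk; apply: IHp => // l rl /=; rewrite rl !rk.
Qed.

(** * Arithmetic, pseudo-division and gcd of formal polynomials *)

Lemma rat_AmulXn a n : rat_qterm a -> rat_qpoly (qe_rcf.AmulXn a n).
Proof.
by move=> ra; elim: n => /= [|n ->]; rewrite ?ra ?rational0.
Qed.

Lemma rat_AddPoly p q : rat_qpoly p -> rat_qpoly q ->
  rat_qpoly (qe_rcf.AddPoly p q).
Proof.
elim: p q => [|a p IHp] [|b q] //= /andP[-> rp] /andP[-> rq].
exact: IHp.
Qed.

Lemma rat_ScalPoly c p : rat_qterm c -> rat_qpoly p ->
  rat_qpoly (qe_rcf.ScalPoly c p).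
Proof. by move=> rc; elim: p => //= a p IHp /andP[-> /IHp->]; rewrite rc. Qed.

Lemma rat_MulPoly p q : rat_qpoly p -> rat_qpoly q ->
  rat_qpoly (qe_rcf.MulPoly p q).
Proof.
move=> + rq; elim: p => //= a p IHp /andP[ra /IHp rpq].
by apply: rat_AddPoly => //; apply: rat_ScalPoly.
Qed.

Lemma rat_ExpPoly p n : rat_qpoly p -> rat_qpoly (qe_rcf.ExpPoly p n).
Proof.
move=> rp; rewrite /qe_rcf.ExpPoly; case: n => // n; rewrite iteropS.
by elim: n => //= n IHn; apply: rat_MulPoly.
Qed.

Lemma rat_OppPoly p : rat_qpoly p -> rat_qpoly (qe_rcf.OppPoly p).
Proof. by apply: rat_ScalPoly; apply: (rational_int (-1)). Qed.

Lemma rat_Deriv p : rat_qpoly p -> rat_qpoly (qe_rcf.Deriv p).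
Proof.
by elim: p => //= a p IHp /andP[_ rp]; apply: rat_AddPoly => //=; apply: IHp.
Qed.

Lemma rat_Rediv_rec_loop q sq cq c qq r n k :
  rat_qpoly q -> rat_qterm cq -> rat_qpoly qq -> rat_qpoly r ->
  (forall c qq r, rat_qpoly qq -> rat_qpoly r -> rat_qform (k (c, qq, r))) ->
  rat_qform (qe_rcf.Rediv_rec_loop q sq cq c qq r n k).
Proof.
move=> rq rcq + + rk.
have cqP : rat_qpoly [:: cq] by rewrite /= rcq.
elim: n c qq r => [|n IHn] c qq r rqq rr /=; apply: rat_Size => // m;
  case: ltnP => _; do ?exact: rk; apply: rat_LeadCoef => // l rl;
  first [apply: IHn|apply: rk];
  do ?[done|apply: rat_AddPoly|apply: rat_OppPoly|apply: rat_MulPoly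
      |apply: rat_AmulXn].
Qed.

Lemma rat_Rediv p q k : rat_qpoly p -> rat_qpoly q ->
  (forall c qq r, rat_qpoly qq -> rat_qpoly r -> rat_qform (k (c, qq, r))) ->
  rat_qform (qe_rcf.Rediv p q k).
Proof.
move=> rp rq rk; have r0 : rat_qpoly [:: qe_rcf.Const 0].
  by rewrite /= rational0.
apply: rat_Isnull => // -[]; first exact: rk.
apply: rat_Size => // n; apply: rat_Size => // m.
apply: rat_LeadCoef => // l rl.
exact: rat_Rediv_rec_loop.
Qed.

Lemma rat_Rmod p q k : rat_qpoly p -> rat_qpoly q -> preserves rat_qpoly k ->
  rat_qform (qe_rcf.Rmod p q k).
Proof. by move=> rp rq rk; apply: rat_Rediv => // *; apply: rk. Qed.

Lemma rat_Rscal p q k : rat_qpoly p -> rat_qpoly q ->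
  (forall n, rat_qform (k n)) -> rat_qform (qe_rcf.Rscal p q k).
Proof. by move=> rp rq rk; apply: rat_Rediv => // *; apply: rk. Qed.

Lemma rat_Rgcd_loop n p q k : rat_qpoly p -> rat_qpoly q ->
  preserves rat_qpoly k -> rat_qform (qe_rcf.Rgcd_loop n p q k).
Proof.
move=> + + rk; elim: n p q => [|n IHn] p q rp rq /=; apply: rat_Rmod => // r rr;
  apply: rat_Isnull => // -[]; by [apply: rk|apply: IHn].
Qed.

Lemma rat_Rgcd p q k : rat_qpoly p -> rat_qpoly q ->
  preserves rat_qpoly k -> rat_qform (qe_rcf.Rgcd p q k).
Proof.
move=> rp rq rk; apply: rat_Size => // m; apply: rat_Size => // n.
case: ltnP => _; apply: rat_Isnull => // -[]; do ?exact: rk;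
  by apply: rat_Size => // l; apply: rat_Rgcd_loop.
Qed.

Lemma rat_BigRgcd ps k : all rat_qpoly ps -> preserves rat_qpoly k ->
  rat_qform (qe_rcf.BigRgcd ps k).
Proof.
elim: ps k => [|p ps IHps] k /=.
  by move=> _; apply; rewrite /= rational0.
by move=> /andP[rp rps] rk; apply: IHps => // r rr; apply: rat_Rgcd.
Qed.

(** * Sign changes, Tarski queries and counting of sign conditions *)

Lemma rat_Changes s k : rat_qpoly s -> (forall n, rat_qform (k n)) ->
  rat_qform (qe_rcf.Changes s k).
Proof.
elim: s k => [|a s IHs] k //= /andP[ra rs] rk; apply: IHs => // n /=.
by rewrite ra !rk; case: s rs => //= b s /andP[-> _].
Qed.

Lemma rat_SeqPInfty ps k : all rat_qpoly ps -> preserves rat_qpoly k ->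
  rat_qform (qe_rcf.SeqPInfty ps k).
Proof.
elim: ps k => [|p ps IHps] k /=; first by move=> _; apply.
move=> /andP[rp rps] rk; apply: rat_LeadCoef => // l rl.
by apply: IHps => // s rs; apply: rk; rewrite /= rl.
Qed.

Lemma rat_SeqMInfty ps k : all rat_qpoly ps -> preserves rat_qpoly k ->
  rat_qform (qe_rcf.SeqMInfty ps k).
Proof.
elim: ps k => [|p ps IHps] k /=; first by move=> _; apply.
move=> /andP[rp rps] rk; apply: rat_LeadCoef => // l rl.
apply: rat_Size => // n; apply: IHps => // s rs; apply: rk.
by rewrite /= rl rs (rational_int (-1)).
Qed.

Lemma rat_ChangesPoly ps k : all rat_qpoly ps -> (forall z, rat_qform (k z)) ->
  rat_qform (qe_rcf.ChangesPoly ps k).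
Proof.
move=> rps rk; apply: rat_SeqMInfty => // s rs; apply: rat_SeqPInfty => // t rt.
by apply: rat_Changes => // m; apply: rat_Changes => // n; apply: rk.
Qed.

Lemma rat_NextMod p q k : rat_qpoly p -> rat_qpoly q ->
  preserves rat_qpoly k -> rat_qform (qe_rcf.NextMod p q k).
Proof.
move=> rp rq rk; apply: rat_LeadCoef => // l rl; apply: rat_Rscal => // n.
by apply: rat_Rmod => // r rr; apply: rk; apply: rat_ScalPoly.
Qed.

Lemma rat_ModsAux p q n k : rat_qpoly p -> rat_qpoly q ->
  preserves (all rat_qpoly) k -> rat_qform (qe_rcf.ModsAux p q n k).
Proof.
elim: n p q k => [|n IHn] p q k rp rq rk /=; first exact: rk.
apply: rat_Isnull => // -[]; first exact: rk.
apply: rat_NextMod => // r rr; apply: IHn => // s rs.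
by apply: rk; rewrite /= rp.
Qed.

Lemma rat_Mods p q k : rat_qpoly p -> rat_qpoly q ->
  preserves (all rat_qpoly) k -> rat_qform (qe_rcf.Mods p q k).
Proof.
move=> rp rq rk; apply: rat_Size => // m; apply: rat_Size => // n.
exact: rat_ModsAux.
Qed.

Lemma rat_nth ps i : all rat_qpoly ps -> rat_qpoly (nth [::] ps i).
Proof.
move=> rps; case: (ltnP i (size ps)) => [lti|lei]; last by rewrite nth_default.
exact: (all_nthP [::] rps).
Qed.

Lemma rat_PolyComb sq sc : all rat_qpoly sq ->
  rat_qpoly (qe_rcf.PolyComb sq sc).
Proof.
move=> rsq; rewrite /qe_rcf.PolyComb; elim: iota => //= i s IHs.
by apply: rat_MulPoly => //; apply: rat_ExpPoly; apply: rat_nth.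
Qed.

Lemma rat_Pcq sq i : all rat_qpoly sq -> rat_qpoly (qe_rcf.Pcq sq i).
Proof.
move=> rsq; apply: rat_nth; rewrite all_map; apply/allP => sc _ /=.
exact: rat_PolyComb.
Qed.

Lemma rat_TaqR p q k : rat_qpoly p -> rat_qpoly q ->
  (forall z, rat_qform (k z)) -> rat_qform (qe_rcf.TaqR p q k).
Proof.
move=> rp rq rk; apply: rat_Mods => //.
  by apply: rat_MulPoly => //; apply: rat_Deriv.
by move=> s rs; apply: rat_ChangesPoly.
Qed.

Lemma rat_TaqsR p sq i k : rat_qpoly p -> all rat_qpoly sq ->
  preserves rat_qterm k -> rat_qform (qe_rcf.TaqsR p sq i k).
Proof.
move=> rp rsq rk; apply: rat_TaqR => //; first exact: rat_Pcq.
by move=> z; apply: rk; apply: rational_int.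
Qed.

Lemma rat_BoundingPoly sq : all rat_qpoly sq ->
  rat_qpoly (qe_rcf.BoundingPoly sq).
Proof.
move=> rsq; apply: rat_Deriv; elim: sq rsq => //= q s IHs /andP[rq /IHs rs].
exact: rat_MulPoly.
Qed.

(** The coefficients are entries of the inverse of a fixed integer matrix. That matrix is already
    defined over the rationals, and inversion commutes with the embedding of the rationals into
    [F]. *)
Lemma rational_coefs n i : rational (qe_rcf_th.coefs F n i).
Proof.
rewrite /qe_rcf_th.coefs; have [lti|lei] := ltnP i (3 ^ n); last first.
  by rewrite nth_default ?rational0// size_map -cardE card_ord.
rewrite (nth_map (Ordinal lti)) -?cardE ?card_ord// castmxE.
have -> : map_mx (intr : int -> F) (qe_rcf_th.ctmat n) =
    map_mx ratr (map_mx (intr : int -> rat) (qe_rcf_th.ctmat n)).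
  by apply/matrixP => a b; rewrite !mxE ratr_int.
by rewrite -map_invmx mxE rational_ratr.
Qed.

Lemma rat_Coefs n i : rat_qterm (qe_rcf.Coefs F n i).
Proof.
case: n => [|[|n]] /=; first exact: rational_nat; last exact: rational_coefs.
have half : rational 2%:R^-1.
  by rewrite -[2%:R](ratr_nat F) -fmorphV rational_ratr.
by case: i => [|[|[|i]]] //=; rewrite ?nth_nil; apply: rational0.
Qed.

Lemma rat_CcountWeak p sq k : rat_qpoly p -> all rat_qpoly sq ->
  preserves rat_qterm k -> rat_qform (qe_rcf.CcountWeak p sq k).
Proof.
move=> rp rsq rk; rewrite /qe_rcf.CcountWeak.
(* The local loop adds to an accumulator that starts at 0. Before the induction on the number of
   rounds, the accumulator is generalized to any term with rational constants. *)
set aux := (fix aux s i k := match i with 0 => _ | _ => _ end).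
have : rat_qterm (qe_rcf.NatConst F 0) by [].
move: (qe_rcf.NatConst F 0) => s.
elim: (_ ^ _)%N s => /= [|n IHn] s rs; first exact: rk.
apply: rat_TaqsR => // x rx; apply: IHn; apply/andP; split=> //.
by apply/andP; split=> //; apply: rat_Coefs.
Qed.

Lemma rat_CcountGt0 sp sq : all rat_qpoly sp -> all rat_qpoly sq ->
  rat_qform (qe_rcf.CcountGt0 sp sq).
Proof.
move=> rsp rsq; apply: rat_BigRgcd => // p rp; apply: rat_Isnull => // -[] /=.
  apply: rat_CcountWeak => //; first exact: rat_BoundingPoly.
  move=> c rc /=; rewrite rc andbT.
  apply/andP; split; elim: sq rsq => //= q s IHs /andP[rq rs];
    rewrite IHs// andbT.
    by apply: rat_LeadCoef.
  by apply: rat_Size => // n; apply: rat_LeadCoef.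
by apply: rat_CcountWeak.
Qed.

Lemma rat_abstrX i t : rat_qterm t -> rat_qpoly (qe_rcf.abstrX i t).
Proof.
elim: t => //= [n|c -> //|t1 IH1 t2 IH2|t1 IH1|t1 IH1 n|t1 IH1 t2 IH2|t1 IH1 n].
- by case: eqP.
- by move=> /andP[/IH1 r1 /IH2 r2]; apply: rat_AddPoly.
- by move/IH1; apply: rat_OppPoly.
- by move/IH1; apply: rat_ScalPoly.
- by move=> /andP[/IH1 r1 /IH2 r2]; apply: rat_MulPoly.
- by move/IH1; apply: rat_ExpPoly.
Qed.

Lemma rat_wproj i bc : all rat_term bc.1 -> all rat_term bc.2 ->
  rat_form (qe_rcf.qfr_to_formula (qe_rcf.wproj i bc)).
Proof.
move=> rs rt; rewrite rat_qfr_to_formula.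
apply: rat_CcountGt0; rewrite all_map; [apply: sub_all rs|apply: sub_all rt];
  by move=> u ru; apply/rat_abstrX/rat_to_rterm.
Qed.

(** * Disjunctive normal forms and elimination of all quantifiers *)

Definition rat_clause (c : ord.oclause F) :=
  all rat_term (ord.terms_of_oclause c).

Lemma rat_and_odnf b c : all rat_clause b -> all rat_clause c ->
  all rat_clause (ord.and_odnf b c).
Proof.
move=> rb rc; rewrite /ord.and_odnf unlock.
elim: b rb => //= c1 b IHb /andP[rc1 /IHb rb]; rewrite all_cat rb andbT all_map.
apply: sub_all rc => c2 /=; move: rc1; rewrite /rat_clause.
case: c1 => ? ? ? ?; case: c2 => ? ? ? ?; rewrite /= !all_cat.
by move=> /and4P[-> -> -> ->] /and4P[-> -> -> ->].
Qed.

(** The boolean is a polarity: at [true] the clauses are those of the negation of [f], which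
    exchanges concatenation and [and_odnf]. *)
Lemma rat_qf_to_odnf f b : rat_form f -> all rat_clause (ord.qf_to_odnf f b).
Proof.
elim: f b => //=.
- by case=> -[].
- by move=> t1 t2 [] /andP[r1 r2]; rewrite /rat_clause /= r1 r2.
- by move=> t1 t2 [] /andP[r1 r2]; rewrite /rat_clause /= r1 r2.
- by move=> t1 t2 [] /andP[r1 r2]; rewrite /rat_clause /= r1 r2.
- by move=> t [].
- move=> f IHf g IHg b /andP[/IHf rf /IHg rg].
  by case: b; [rewrite all_cat rf rg|apply: rat_and_odnf].
- move=> f IHf g IHg b /andP[/IHf rf /IHg rg].
  by case: b; [apply: rat_and_odnf|rewrite all_cat rf rg].
- move=> f IHf g IHg b /andP[/IHf rf /IHg rg].
  by case: b; [apply: rat_and_odnf|rewrite all_cat rf rg].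
- by move=> f IHf b /IHf.
- by move=> ? ? ? [].
- by move=> ? ? ? [].
Qed.

Definition rcf_wproj i bc := qe_rcf.qfr_to_formula (@qe_rcf.wproj F i bc).

Lemma rat_foldr_Or (fs : seq (ord.formula F)) :
  rat_form (foldr ord.Or (ord.Bool false) fs) = all rat_form fs.
Proof. by elim: fs => //= f fs ->. Qed.

Lemma rat_proj n oc : rat_clause oc -> rat_form (ord.proj rcf_wproj n oc).
Proof.
move=> roc; rewrite /ord.proj rat_foldr_Or all_map /ord.oclause_to_w.
apply/allP => _ /mapP[c cin ->].
(* Removing disequalities and weak inequalities from a clause creates no new terms, up to sign. *)
have rc : rat_clause c.
  apply/allP => t /(ord.terms_of_neq_leq_elim cin); rewrite mem_cat => /orP[].
    by move: t; apply/allP.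
  move=> /mapP[u uin ->] /=; move: u uin; apply/allP; move: roc.
  rewrite /rat_clause; case: oc {cin} => ? ? ? ? /=.
  by rewrite !all_cat => /and4P[].
move: rc; case: c {cin} => eq_l neq_l lt_l le_l.
by rewrite /rat_clause /= !all_cat => /and4P[? _ ? _]; apply: rat_wproj.
Qed.

Lemma rat_quantifier_elim f : rat_form f ->
  rat_form (ord.quantifier_elim rcf_wproj f).
Proof.
have aux g n b : rat_form g -> rat_form (foldr ord.Or (ord.Bool false)
    [seq ord.proj rcf_wproj n i | i <- ord.qf_to_odnf g b]).
  move=> rg; rewrite rat_foldr_Or all_map.
  by apply: sub_all (rat_qf_to_odnf b rg) => c rc; apply: rat_proj.
elim: f => //= [f IHf g IHg|f IHf g IHg|f IHf g IHg|n f IHf|n f IHf].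
- by move=> /andP[/IHf-> /IHg->].
- by move=> /andP[/IHf-> /IHg->].
- by move=> /andP[/IHf-> /IHg->].
- by move/IHf/aux.
- by move/IHf => rf; apply: aux.
Qed.

(** The generic elimination, fed with the one-variable elimination for real closed fields, gives an
    equivalent quantifier-free formula; the preceding lemmas follow its construction and see no
    irrational constant enter. *)
Lemma rational_quantifier_elimination (f : ord.formula F) :
  ord.rformula f -> rat_form f ->
  exists g : ord.formula F, [/\ ord.qf_form g, ord.rformula g, rat_form g &
    forall e, ord.holds e f <-> ord.qf_eval e g].
Proof.
move=> ff rf; have wf := @qe_rcf.wf_QE_wproj F.
exists (ord.quantifier_elim rcf_wproj f).
have /andP[-> ->] := ord.quantifier_elim_wf wf ff.
split=> // [|e]; first exact: rat_quantifier_elim.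
by apply: rwP; apply: ord.quantifier_elim_rformP => //;
  apply: qe_rcf.valid_QE_wproj.
Qed.

End RationalConstants.

(** * Recursive functions *)

Section RecursiveFunctions.
Local Open Scope nat_scope.
Implicit Types (F G : seq nat -> nat) (P Q : seq nat -> bool).

(* Arguments are passed as untyped lists, read with default value 0, so that
   only the length [n] of the relevant lists has to be tracked. *)
Definition trec (n : nat) (F : seq nat -> nat) : Prop :=
  partial_recursive (fun (x : n.-tuple nat) y => y = F x).

Definition drec (n : nat) (P : seq nat -> bool) : Prop :=
  trec n (fun s => P s).

Lemma trec_ext n F G : (forall s, size s = n -> F s = G s) ->
  trec n F -> trec n G.
Proof. by move=> FG; apply: pr_ext => x y; rewrite FG ?size_tuple. Qed.

Lemma trec_nth n i : trec n (fun s => nth 0 s i).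
Proof.
case: (ltnP i n) => [lti|lei].
  by apply: pr_ext (pr_proj (Ordinal lti)) => x y; rewrite (tnth_nth 0).
by apply: pr_ext (pr_zero n) => x y; rewrite nth_default ?size_tuple.
Qed.

Lemma trec_subst m n G (hs : seq (seq nat -> nat)) : size hs = m ->
  trec m G -> (forall i, i < m -> trec n (nth (fun=> 0) hs i)) ->
  trec n (fun s => G [seq h s | h <- hs]).
Proof.
move=> sz rG rh.
apply: pr_ext (pr_comp rG (fun i : 'I_m => rh i (ltn_ord i))) => x y.
have sz' : size [seq h (tval x) | h <- hs] == m by rewrite size_map sz.
split=> [[z zh ->]|->].
  congr G; apply: (@eq_from_nth _ 0); rewrite ?(eqP sz') ?size_tuple// => i lti.
  rewrite (nth_map (fun=> 0)) ?sz//.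
  by rewrite -(zh (Ordinal lti)) (tnth_nth 0).
exists (Tuple sz') => // i.
by rewrite (tnth_nth 0) /= (nth_map (fun=> 0)) ?sz.
Qed.

Lemma trec_comp1 n f G : trec 1 (fun s => f (nth 0 s 0)) -> trec n G ->
  trec n (fun s => f (G s)).
Proof.
by move=> rf rG; apply: (trec_subst (hs := [:: G])) rf _ => // -[].
Qed.

Lemma recursive_trec f : recursive f -> trec 1 (fun s => f (nth 0 s 0)).
Proof.
by apply: pr_ext => x y; rewrite /thead (tnth_nth 0).
Qed.

Lemma trec_recursive n f G : recursive f -> trec n G ->
  trec n (fun s => f (G s)).
Proof. by move=> rf; apply/trec_comp1/recursive_trec. Qed.

Lemma trec_succ n G : trec n G -> trec n (fun s => (G s).+1).
Proof.
apply: (@trec_comp1 n S).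
by apply: pr_ext pr_succ => x y; rewrite /thead (tnth_nth 0).
Qed.

Lemma trec_const n c : trec n (fun=> c).
Proof.
by elim: c => [|c IHc]; [exact: pr_zero|exact: trec_succ IHc].
Qed.

Lemma primrec_graphE n g h k (x : n.-tuple nat) y :
  primrec_graph (fun (x : n.-tuple nat) y => y = g (tval x))
    (fun (x : n.+2.-tuple nat) y => y = h (tval x)) k x y <->
  y = iteri k (fun k z => h (k :: z :: tval x)) (g x).
Proof.
elim: k y => //= k IHk y; split=> [[z /IHk -> ->] //|->].
by exists (iteri k (fun k z => h (k :: z :: tval x)) (g x)); rewrite ?IHk.
Qed.

Lemma trec_nths n F (l : seq nat) : trec (size l) F ->
  trec n (fun s => F [seq nth 0 s i | i <- l]).
Proof.
move=> rF; apply: (@trec_ext n (fun s => F [seq h s | h <-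
  [seq (fun t => nth 0 t i) | i <- l]])) => [s _|].
  by rewrite -map_comp.
apply: (trec_subst _ rF) => [|i lti]; first exact: size_map.
by rewrite (nth_map 0)//; apply: trec_nth.
Qed.

Lemma map_nth_iota (s : seq nat) m k : size s = m + k ->
  [seq nth 0 s i | i <- iota m k] = drop m s.
Proof.
move=> sz; rewrite -{2}[s](mkseq_nth 0) /mkseq -map_drop drop_iota sz.
by rewrite add0n addKn.
Qed.

Lemma trec_drop m n F : trec n F -> trec (m + n) (fun s => F (drop m s)).
Proof.
move=> rF; apply: (@trec_ext _ (fun s => F [seq nth 0 s i | i <- iota m n])).
  by move=> s sz; rewrite map_nth_iota.
by apply: trec_nths; rewrite size_iota.
Qed.

(** The arithmetic operations below are iterations of this form or are composed from them. In the
    proof, [I] is the primitive recursion with its counter as first argument; composing it with [b]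
    and the projections puts [b s] in place of the counter. *)
Lemma trec_iteri n b g h : trec n b -> trec n g -> trec n.+2 h ->
  trec n (fun s => iteri (b s) (fun k z => h (k :: z :: s)) (g s)).
Proof.
move=> rb rg rh.
pose I s := iteri (head 0 s) (fun k z => h (k :: z :: behead s)) (g (behead s)).
have rI : trec n.+1 I.
  apply: pr_ext (pr_primrec rg rh) => x y.
  by case/tupleP: x => k x; rewrite theadE primrec_graphE /I.
pose hs := b :: [seq (fun t => nth 0 t i) | i <- iota 0 n].
apply: (@trec_ext n (fun s => I [seq f s | f <- hs])) => [s sz|].
  rewrite /I /= -map_comp.
  by rewrite (@map_nth_iota s 0 n) ?drop0.
apply: (trec_subst _ rI); first by rewrite /= size_map size_iota.
case=> //= i lti; rewrite (nth_map 0) ?size_iota// nth_iota//.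
exact: trec_nth.
Qed.

Lemma trec_add n F G : trec n F -> trec n G -> trec n (fun s => F s + G s).
Proof.
move=> rF rG; apply: trec_ext (trec_iteri rG rF (trec_succ (trec_nth _ 1))).
by move=> s _; elim: (G s) => [|k IHk] /=; rewrite ?addn0 ?IHk ?addnS.
Qed.

Lemma trec_pred n F : trec n F -> trec n (fun s => (F s).-1).
Proof.
(* The step returns its counter, whose last value is one below the bound. *)
move=> rF; apply: trec_ext (trec_iteri rF (trec_const n 0) (trec_nth _ 0)).
by move=> s _; case: (F s).
Qed.

Lemma trec_sub n F G : trec n F -> trec n G -> trec n (fun s => F s - G s).
Proof.
move=> rF rG; apply: trec_ext (trec_iteri rG rF (trec_pred (trec_nth _ 1))).
by move=> s _; elim: (G s) => [|k IHk] /=; rewrite ?subn0 ?IHk ?subnS.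
Qed.

Lemma trec_mul n F G : trec n F -> trec n G -> trec n (fun s => F s * G s).
Proof.
move=> rF rG; have rh : trec n.+2 (fun t => nth 0 t 1 + F (drop 2 t)).
  exact: trec_add (trec_nth _ 1) (trec_drop 2 rF).
apply: trec_ext (trec_iteri rG (trec_const n 0) rh) => s _.
by elim: (G s) => [|k IHk] /=; rewrite ?muln0 // IHk /= drop0 mulnSr.
Qed.

Lemma trec_exp2 n F : trec n F -> trec n (fun s => 2 ^ F s).
Proof.
move=> rF; have rh : trec n.+2 (fun t => nth 0 t 1 + nth 0 t 1).
  by apply: trec_add; apply: trec_nth.
apply: trec_ext (trec_iteri rF (trec_const n 1) rh) => s _.
by elim: (F s) => //= k ->; rewrite expnS mul2n addnn.
Qed.

Lemma drec_not n P : drec n P -> drec n (fun s => ~~ P s).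
Proof.
move=> dP; apply: trec_ext (trec_sub (trec_const n 1) dP) => s _.
by case: (P s).
Qed.

Lemma drec_and n P Q : drec n P -> drec n Q -> drec n (fun s => P s && Q s).
Proof.
by move=> dP dQ; apply: trec_ext (trec_mul dP dQ) => s _; rewrite mulnb.
Qed.

Lemma drec_ext n P Q : (forall s, size s = n -> P s = Q s) ->
  drec n P -> drec n Q.
Proof. by move=> PQ; apply: trec_ext => s sz; rewrite PQ. Qed.

Lemma drec_eq0 n F : trec n F -> drec n (fun s => F s == 0).
Proof.
move=> rF; apply: trec_ext (trec_sub (trec_const n 1) rF) => s _.
by case: (F s) => [|[]].
Qed.

Lemma drec_leq n F G : trec n F -> trec n G -> drec n (fun s => F s <= G s).
Proof. by move=> rF rG; apply/drec_eq0/trec_sub. Qed.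

Lemma drec_const n b : drec n (fun=> b).
Proof. exact: trec_const. Qed.

Lemma drec_or n P Q : drec n P -> drec n Q -> drec n (fun s => P s || Q s).
Proof.
move=> /drec_not dP /drec_not dQ; apply: drec_ext (drec_not (drec_and dP dQ)).
by move=> s _; rewrite negb_and !negbK.
Qed.

Lemma drec_odd n F : trec n F -> drec n (fun s => odd (F s)).
Proof.
move=> rF; have dh : drec n.+2 (fun t => nth 0 t 1 == 0).
  exact/drec_eq0/trec_nth.
apply: trec_ext (trec_iteri rF (trec_const n 0) dh) => s _.
by elim: (F s) => //= k ->; case: odd.
Qed.

Lemma trec_half n F : trec n F -> trec n (fun s => (F s)./2).
Proof.
move=> rF; have rh : trec n.+2 (fun t => odd (nth 0 t 0) + nth 0 t 1).
  exact: trec_add (drec_odd (trec_nth _ 0)) (trec_nth _ 1).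
apply: trec_ext (trec_iteri rF (trec_const n 0) rh) => s _.
by elim: (F s) => //= k ->; rewrite uphalf_half.
Qed.

Lemma trec_div_exp2 n F G : trec n F -> trec n G ->
  trec n (fun s => F s %/ 2 ^ G s).
Proof.
move=> rF rG; apply: trec_ext (trec_iteri rG rF (trec_half (trec_nth _ 1))).
move=> s _; elim: (G s) => /= [|k ->]; first by rewrite divn1.
by rewrite expnSr divnMA divn2.
Qed.

Lemma trec_cantor_pair n F G : trec n F -> trec n G ->
  trec n (fun s => cantor_pair (F s) (G s)).
Proof.
by move=> rF rG; apply: trec_add => //; apply: trec_half; apply: trec_mul;
  [|apply: trec_succ]; apply: trec_add.
Qed.

Lemma drec_has n F P : trec n F -> drec n.+1 P ->
  drec n (fun s => has (fun i => P (i :: s)) (iota 0 (F s))).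
Proof.
(* The step sees the counter, the accumulator and then [s]; the indices [0 :: iota 2 n] leave out
   the accumulator. *)
move=> rF dP; have dh : drec n.+2 (fun t => (nth 0 t 1 != 0) ||
    P [seq nth 0 t i | i <- 0 :: iota 2 n]).
  apply: drec_or; first exact/drec_not/drec_eq0/trec_nth.
  by apply: (@trec_nths _ P); rewrite /= size_iota.
apply: trec_ext (trec_iteri rF (trec_const n 0) dh) => s sz.
elim: (F s) => // k IHk; rewrite -addn1 iotaD has_cat addn1 /= IHk orbF.
by rewrite map_nth_iota /= ?sz// drop0; case: has.
Qed.

Lemma drec_all n F P : trec n F -> drec n.+1 P ->
  drec n (fun s => all (fun i => P (i :: s)) (iota 0 (F s))).
Proof.
move=> rF /drec_not dP; apply: drec_ext (drec_not (drec_has rF dP)) => s _.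
by rewrite has_predC negbK.
Qed.

(** Minimization is applied to a function that ignores the search variable: it stops at 0 if [P]
    holds and diverges otherwise. *)
Lemma drec_re n P : drec n P ->
  recursively_enumerable (fun x : n.-tuple nat => P x).
Proof.
move=> /drec_not dP.
have dP' : drec n.+1 (fun s => ~~ P (behead s)).
  by apply: drec_ext (trec_drop 1 dP) => s _; rewrite drop1.
exists (fun x y => y = 0 /\ P x); split; last first.
  by move=> x; split=> [Px|[y []]//]; exists 0.
apply: pr_ext (pr_min dP') => x y /=; split.
  case; case: (P x) => // _; case: y => // y /(_ 0 isT)[v]; by case: (P x).
by case=> -> ->.
Qed.

End RecursiveFunctions.

(** * Recursive rational functions *)

Section RationalFunctions.
Variable n : nat.
Implicit Types F G : seq nat -> rat.

(** The shape of [num_rat]: with a difference of naturals above and a successor below, signs and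
    zero denominators never have to be treated, and only recursive functions on naturals occur. *)
Definition ratrec F : Prop :=
  exists p m d : seq nat -> nat, [/\ trec n p, trec n m, trec n d &
    forall s, size s = n -> F s = ((p s)%:R - (m s)%:R) / (d s).+1%:R].

Lemma ratrec_ext F G : (forall s, size s = n -> F s = G s) ->
  ratrec F -> ratrec G.
Proof.
move=> FG [p [m [d [rp rm rd FE]]]]; exists p, m, d.
by split=> // s sz; rewrite -FG ?FE.
Qed.

Lemma ratrec_const q : ratrec (fun=> q).
Proof.
have [d dE] : exists d : nat, denq q = d.+1.
  by have := denq_gt0 q; case: (denq q) => [[|d]|] // _; exists d.
have qE : q = (numq q)%:~R / d.+1%:R by rewrite -{1}[q]divq_num_den dE.
case: (numq q) qE => k qE; [exists (fun=> k), (fun=> 0%N)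
  |exists (fun=> 0%N), (fun=> k.+1)]; exists (fun=> d);
  split; do ?[exact: trec_const]; move=> s _; rewrite qE.
  by rewrite subr0.
by rewrite NegzE mulrNz sub0r.
Qed.

(** Gives the predecessor of a product of two denominators without subtraction. *)
Let succM a b : (a.+1 * b.+1 = (a * b + a + b).+1)%N.
Proof. by rewrite mulSn mulnS; lia. Qed.

Lemma ratrec_add F G : ratrec F -> ratrec G -> ratrec (fun s => F s + G s).
Proof.
move=> [p [m [d [rp rm rd FE]]]] [p' [m' [d' [rp' rm' rd' GE]]]].
exists (fun s => p s * (d' s).+1 + p' s * (d s).+1)%N.
exists (fun s => m s * (d' s).+1 + m' s * (d s).+1)%N.
exists (fun s => d s * d' s + d s + d' s)%N; split;
  do ?[exact: trec_mul|apply: trec_add|apply: trec_mul|apply: trec_succ] => //.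
move=> s sz; rewrite FE// GE// addf_div ?pnatr_eq0// -natrM succM.
by congr (_ / _); rewrite !natrD !natrM; ring.
Qed.

Lemma ratrec_opp F : ratrec F -> ratrec (fun s => - F s).
Proof.
move=> [p [m [d [rp rm rd FE]]]]; exists m, p, d; split=> // s sz.
by rewrite FE// -mulNr opprB.
Qed.

Lemma ratrec_mul F G : ratrec F -> ratrec G -> ratrec (fun s => F s * G s).
Proof.
move=> [p [m [d [rp rm rd FE]]]] [p' [m' [d' [rp' rm' rd' GE]]]].
exists (fun s => p s * p' s + m s * m' s)%N.
exists (fun s => p s * m' s + m s * p' s)%N.
exists (fun s => d s * d' s + d s + d' s)%N; split;
  do ?[exact: trec_mul|apply: trec_add] => //.
move=> s sz; rewrite FE// GE// mulf_div -natrM succM.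
by congr (_ / _); rewrite !natrD !natrM; ring.
Qed.

Lemma ratrec_exp F k : ratrec F -> ratrec (fun s => F s ^+ k).
Proof.
move=> rF; elim: k => [|k IHk]; first exact: ratrec_const.
by apply: ratrec_ext (ratrec_mul rF IHk) => s _; rewrite exprS.
Qed.

(** Denominators are positive, so the order is read off the numerator of [G - F]. *)
Lemma drec_rat_le F G : ratrec F -> ratrec G -> drec n (fun s => F s <= G s).
Proof.
move=> /ratrec_opp rF rG.
have [p [m [d [rp rm rd GFE]]]] := ratrec_add rG rF.
apply: drec_ext (drec_leq rm rp) => s sz.
by rewrite -subr_ge0 GFE// pmulr_lge0 ?invr_gt0 ?ltr0n// subr_ge0 ler_nat.
Qed.

Lemma drec_rat_lt F G : ratrec F -> ratrec G -> drec n (fun s => F s < G s).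
Proof.
move=> rF rG; apply: drec_ext (drec_not (drec_rat_le rG rF)) => s _.
by rewrite ltNge.
Qed.

Lemma drec_rat_eq F G : ratrec F -> ratrec G -> drec n (fun s => F s == G s).
Proof.
move=> rF rG.
apply: drec_ext (drec_and (drec_rat_le rF rG) (drec_rat_le rG rF)) => s _.
by rewrite eq_le.
Qed.

Variables (R : rcfType) (E : seq nat -> seq rat).
Hypothesis ratrecE : forall i, ratrec (fun s => (E s)`_i).
Let env s : seq R := map ratr (E s).

(** Without inverses, which [rterm] excludes, a term is a polynomial expression; [rat_term] makes
    its constants rational, so the whole evaluation takes place among the rationals. *)
Lemma ratrec_eval (t : GRing.term R) : GRing.rterm t -> rat_term t ->
  exists2 V, ratrec V & forall s, GRing.eval (env s) t = ratr (V s).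
Proof.
elim: t => //= [i _ _|c _ /asboolP[q ->]|k _ _|t1 IH1 t2 IH2|t1 IH1|t1 IH1 k
  |t1 IH1 t2 IH2|t1 IH1 k].
- exists (fun s => (E s)`_i) => // s; rewrite /env.
  have [lti|lei] := ltnP i (size (E s)); first by rewrite (nth_map 0).
  by rewrite !nth_default ?size_map// raddf0.
- by exists (fun=> q) => //; apply: ratrec_const.
- by exists (fun=> k%:R) => [|s]; [apply: ratrec_const|rewrite /= ratr_nat].
- move=> /andP[r1 r2] /andP[q1 q2].
  have [V1 rV1 V1E] := IH1 r1 q1; have [V2 rV2 V2E] := IH2 r2 q2.
  exists (fun s => V1 s + V2 s) => [|s]; first exact: ratrec_add.
  by rewrite V1E V2E raddfD.
- move=> r1 q1; have [V1 rV1 V1E] := IH1 r1 q1.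
  exists (fun s => - V1 s) => [|s]; first exact: ratrec_opp.
  by rewrite V1E raddfN.
- move=> r1 q1; have [V1 rV1 V1E] := IH1 r1 q1.
  exists (fun s => V1 s * k%:R) => [|s].
    by apply: ratrec_mul => //; apply: ratrec_const.
  by rewrite V1E rmorphM /= ratr_nat mulr_natr.
- move=> /andP[r1 r2] /andP[q1 q2].
  have [V1 rV1 V1E] := IH1 r1 q1; have [V2 rV2 V2E] := IH2 r2 q2.
  exists (fun s => V1 s * V2 s) => [|s]; first exact: ratrec_mul.
  by rewrite V1E V2E rmorphM.
- move=> r1 q1; have [V1 rV1 V1E] := IH1 r1 q1.
  exists (fun s => V1 s ^+ k) => [|s]; first exact: ratrec_exp.
  by rewrite V1E rmorphXn.
Qed.

(** The embedding [ratr] preserves and reflects equality and order, so each atom is decided by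
    comparing rationals. *)
Lemma drec_qf_eval (g : ord.formula R) : ord.qf_form g -> ord.rformula g ->
  rat_form g -> drec n (fun s => ord.qf_eval (env s) g).
Proof.
elim: g => //= [b|t1 t2|t1 t2|t1 t2|f IHf g IHg|f IHf g IHg|f IHf g IHg|f IHf].
- by move=> _ _ _; apply: drec_const.
- move=> _ /andP[r1 r2] /andP[q1 q2].
  have [V1 rV1 V1E] := ratrec_eval r1 q1.
  have [V2 rV2 V2E] := ratrec_eval r2 q2.
  apply: drec_ext (drec_rat_eq rV1 rV2) => s _.
  by rewrite V1E V2E (inj_eq (fmorph_inj _)).
- move=> _ /andP[r1 r2] /andP[q1 q2].
  have [V1 rV1 V1E] := ratrec_eval r1 q1.
  have [V2 rV2 V2E] := ratrec_eval r2 q2.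
  by apply: drec_ext (drec_rat_lt rV1 rV2) => s _; rewrite V1E V2E ltr_rat.
- move=> _ /andP[r1 r2] /andP[q1 q2].
  have [V1 rV1 V1E] := ratrec_eval r1 q1.
  have [V2 rV2 V2E] := ratrec_eval r2 q2.
  by apply: drec_ext (drec_rat_le rV1 rV2) => s _; rewrite V1E V2E ler_rat.
- move=> /andP[? ?] /andP[? ?] /andP[? ?].
  by apply: drec_and; [apply: IHf|apply: IHg].
- move=> /andP[? ?] /andP[? ?] /andP[? ?].
  by apply: drec_or; [apply: IHf|apply: IHg].
- move=> /andP[? ?] /andP[? ?] /andP[? ?].
  apply: drec_ext (drec_or (drec_not (IHf _ _ _)) (IHg _ _ _)) => // s _.
  by rewrite implybE.
- by move=> qf rf tf; apply/drec_not/IHf.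
Qed.

End RationalFunctions.

(** * Locality of first-order formulas, and codings *)

Section FirstOrder.
Variable R : realDomainType.
Implicit Types (e : seq R) (t : GRing.term R) (f : ord.formula R).

Lemma eval_local t : exists M, forall e e',
  (forall i, (i < M)%N -> e`_i = e'`_i) -> GRing.eval e t = GRing.eval e' t.
Proof.
elim: t => /= [i|c|k|t1 [M1 IH1] t2 [M2 IH2]|t1 [M IH]|t1 [M IH] k
  |t1 [M1 IH1] t2 [M2 IH2]|t1 [M IH]|t1 [M IH] k].
- by exists i.+1 => e e'; apply.
- by exists 0%N.
- by exists 0%N.
- exists (maxn M1 M2) => e e' ee'.
  by rewrite (IH1 _ e') ?(IH2 _ e')// => i lti; rewrite ee'// leq_max lti ?orbT.
- by exists M => e e' /IH->.
- by exists M => e e' /IH->.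
- exists (maxn M1 M2) => e e' ee'.
  by rewrite (IH1 _ e') ?(IH2 _ e')// => i lti; rewrite ee'// leq_max lti ?orbT.
- by exists M => e e' /IH->.
- by exists M => e e' /IH->.
Qed.

(** Yields positions that [f] does not read, where parameters can be stored. A quantifier changes
    both environments at the same place, so the bound of its body still serves. *)
Lemma holds_local f : exists M, forall e e',
  (forall i, (i < M)%N -> e`_i = e'`_i) -> ord.holds e f <-> ord.holds e' f.
Proof.
have max2 (P Q : seq R -> seq R -> Prop) :
    (exists M, forall e e', (forall i, (i < M)%N -> e`_i = e'`_i) -> P e e') ->
    (exists M, forall e e', (forall i, (i < M)%N -> e`_i = e'`_i) -> Q e e') ->
  exists M, forall e e', (forall i, (i < M)%N -> e`_i = e'`_i) ->
    P e e' /\ Q e e'.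
  move=> [M1 HP] [M2 HQ]; exists (maxn M1 M2) => e e' ee'.
  by split; [apply: HP|apply: HQ] => i lti; rewrite ee'// leq_max lti ?orbT.
elim: f => /= [b|t1 t2|t1 t2|t1 t2|t|f IHf g IHg|f IHf g IHg|f IHf g IHg|f IHf
  |n f [M IHf]|n f [M IHf]].
- by exists 0%N.
- have [M HM] := max2 _ _ (eval_local t1) (eval_local t2).
  by exists M => e e' /HM[-> ->].
- have [M HM] := max2 _ _ (eval_local t1) (eval_local t2).
  by exists M => e e' /HM[-> ->].
- have [M HM] := max2 _ _ (eval_local t1) (eval_local t2).
  by exists M => e e' /HM[-> ->].
- by have [M HM] := eval_local t; exists M => e e' /HM->.
- by have [M HM] := max2 _ _ IHf IHg; exists M => e e' /HM; tauto.
- by have [M HM] := max2 _ _ IHf IHg; exists M => e e' /HM; tauto.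
- by have [M HM] := max2 _ _ IHf IHg; exists M => e e' /HM; tauto.
- by have [M HM] := IHf; exists M => e e' /HM; tauto.
- exists M => e e' ee'.
  have ee'x x i : (i < M)%N -> (set_nth 0 e n x)`_i = (set_nth 0 e' n x)`_i.
    by move=> lti; rewrite !nth_set_nth /= ee'.
  by split=> -[x Hx]; exists x; have := IHf _ _ (ee'x x); tauto.
- exists M => e e' ee'.
  have ee'x x i : (i < M)%N -> (set_nth 0 e n x)`_i = (set_nth 0 e' n x)`_i.
    by move=> lti; rewrite !nth_set_nth /= ee'.
  by split=> Hx x; [rewrite -(IHf _ _ (ee'x x))|rewrite (IHf _ _ (ee'x x))].
Qed.

(** Each quantifier overwrites one entry, so a block of them overwrites a segment. The length
    hypothesis keeps every [set_nth] inside the list, where it pads nothing. *)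
Lemma holds_foldr_Forall f j m e : (j + m <= size e)%N ->
  ord.holds e (foldr (@ord.Forall R) f (iota j m)) <->
  forall v, size v = m -> ord.holds (take j e ++ v ++ drop (j + m) e) f.
Proof.
elim: m j e => [|m IHm] j e sz /=.
  split=> [Hf v /size0nil->|/(_ [::] erefl)];
  by rewrite /= addn0 cat_take_drop.
have ltj : (j < size e)%N by lia.
have split_e x v : take j.+1 (set_nth 0 e j x) ++ v ++
    drop (j.+1 + m) (set_nth 0 e j x) =
    take j e ++ (x :: v) ++ drop (j + m.+1) e.
  have -> : set_nth 0 e j x = (take j e ++ [:: x]) ++ drop j.+1 e.
    by rewrite set_nthE ltj -catA.
  rewrite take_size_cat; last by rewrite size_cat size_take ltj addn1.
  rewrite drop_cat size_cat size_take ltj /= addn1 ltnNge leq_addr /= addKn.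
  by rewrite drop_drop -!catA /= addnC addSnnS.
split=> [Hf [//|x v] [sv]|Hf x].
  rewrite -split_e; apply: (IHm j.+1 _ _).1 => //.
  by rewrite size_set_nth; lia.
apply/IHm => [|v sv]; first by rewrite size_set_nth; lia.
by rewrite split_e; apply: Hf; rewrite /= sv.
Qed.

Lemma holds_foldr_And (fs : seq (ord.formula R)) e :
  ord.holds e (foldr (@ord.And R) (ord.Bool true) fs) <->
  forall i, (i < size fs)%N -> ord.holds e (nth (ord.Bool true) fs i).
Proof.
elim: fs => //= f fs IH; split=> [[Hf /IH Hfs] [|i] //|Hfs]; first exact: Hfs.
by split; [apply: (Hfs 0%N)|apply/IH => i; apply: (Hfs i.+1)].
Qed.

End FirstOrder.

(** * Cantor pairing and canonical indices of finite sets *)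

Section Codings.
Local Open Scope nat_scope.

(** With [T] the triangular numbers, the codes of pairs of sum [s] lie from [T s] to [T s + s],
    below [T s.+1]. The code thus determines the sum, and then the first component. *)
Lemma cantor_pair_inj a b a' b' :
  cantor_pair a b = cantor_pair a' b' -> a = a' /\ b = b'.
Proof.
have [T TE TS] : exists2 T, forall n, (n * n.+1)./2 = T n &
    forall n, T n.+1 = T n + n.+1.
  exists (fun n => (n * n.+1)./2) => // n.
  have -> : n.+1 * n.+2 = n.+1.*2 + n * n.+1 by nia.
  by rewrite halfD odd_double doubleK /= add0n addnC.
have leT n k : T n <= T (n + k).
  by elim: k => [|k IHk]; rewrite ?addn0// addnS TS; lia.
have lt_sum c d c' d' : c + d < c' + d' -> T (c + d) + c < T (c' + d') + c'.
  move=> lt_cd; have := leT (c + d).+1 (c' + d' - (c + d).+1).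
  by rewrite subnKC// TS; lia.
rewrite /cantor_pair !TE => eq_c.
have := lt_sum a b a' b'; have := lt_sum a' b' a b.
case: (ltngtP (a + b) (a' + b')) => [|| eq_s]; rewrite ?eq_c; try lia.
by move: eq_c; rewrite eq_s; lia.
Qed.

Lemma leq_cantor_pair a b : a <= cantor_pair a b /\ b <= cantor_pair a b.
Proof.
rewrite /cantor_pair; have : a + b <= ((a + b) * (a + b).+1)./2; last lia.
case: (a + b) => // n; rewrite -[X in X <= _](doubleK n.+1) half_leq//.
by rewrite -muln2 leq_mul.
Qed.

Lemma canonical_set_lt u c : canonical_set u c -> c < u.
Proof.
move=> uc; have : 0 < u %/ 2 ^ c by apply: odd_gt0.
rewrite divn_gt0 ?expn_gt0// => /(leq_trans _); apply.
exact: ltn_expl.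
Qed.

(** The index is built from its lowest binary digit: [p 0] is that digit, and the shifted predicate
    supplies the others. *)
Lemma canonical_set_bounded (p : pred nat) b :
  exists u, forall c, canonical_set u c <-> (c < b) && p c.
Proof.
elim: b p => [|b IHb] p.
  by exists 0 => c; rewrite /canonical_set /= div0n.
have [u uE] := IHb (p \o S); exists (p 0 + u.*2) => -[|c].
  by rewrite /canonical_set /= divn1 oddD odd_double addbF oddb.
rewrite ltnS -uE /canonical_set /= expnS divnMA divn2.
by rewrite halfD odd_double andbF doubleK; case: (p 0).
Qed.

End Codings.

(** * The search operator *)

Section Search.
Local Open Scope classical_set_scope.
Local Open Scope nat_scope.
Variable P : seq nat -> bool.
Hypothesis drecP : drec 4 P.

(* A candidate at stage [k], where [a = f k], is an output [y <= k]; the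
   search stops at the first stage that has a candidate. *)
Definition first_candidate x k a y :=
  [&& y <= k, P [:: x; k; y; a] &
      ~~ has (fun y' => P [:: x; k; y'; a]) (iota 0 y)].

Definition no_candidate x k a :=
  ~~ has (fun y => P [:: x; k; y; a]) (iota 0 k.+1).

(** Earlier stages must be defined and must fail. Each result thus rests on finitely many values of
    [f] and persists when [f] is extended, as an enumeration operator requires. *)
Definition search_result (f : pfun) x y :=
  exists k a, [/\ f k = Some a, first_candidate x k a y &
    forall i, i < k -> exists2 a', f i = Some a' & no_candidate x i a'].

(** If two successful stages differed, the later one would require the earlier one to fail. At a
    common stage, both outputs are the least candidate. *)
Lemma search_result_fun f x y y' :
  search_result f x y -> search_result f x y' -> y = y'.
Proof.
move=> [k [a [fk ca na]]] [k' [a' [fk' ca' na']]].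
have cand i b z : first_candidate x i b z -> ~~ no_candidate x i b.
  move=> /and3P[lez Pz _]; rewrite negbK; apply/hasP; exists z => //.
  by rewrite mem_iota.
have eq_k : k = k'.
  case: (ltngtP k k') => // [/na'[b]|/na[b]].
    by rewrite fk => -[<-]; rewrite (negPf (cand _ _ _ ca)).
  by rewrite fk' => -[<-]; rewrite (negPf (cand _ _ _ ca')).
subst k'; move: fk' ca'; rewrite fk => -[<-] ca'.
move: ca ca' => /and3P[_ Py /hasPn ny] /and3P[_ Py' /hasPn ny'].
case: (ltngtP y y') => // lty.
  by have := ny' y; rewrite mem_iota Py => /(_ lty).
by have := ny y'; rewrite mem_iota Py' => /(_ lty).
Qed.

(** Take the least stage with a candidate, then its least candidate; minimality also keeps the
    output within the stage bound. *)
Lemma search_result_exists (f : pfun) (g : nat -> nat) x :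
  (forall i, f i = Some (g i)) ->
  (exists k y, y <= k /\ P [:: x; k; y; g k]) ->
  exists2 y, search_result f x y & exists k, P [:: x; k; y; g k].
Proof.
move=> fg [k [y [leyk Py]]].
have ex_stage : exists k, ~~ no_candidate x k (g k).
  by exists k; rewrite negbK; apply/hasP; exists y; rewrite ?mem_iota.
case: (ex_minnP ex_stage) => k0 cand0 min_k0.
have /hasP[y0] := negbNE cand0; rewrite mem_iota => /= ley0 Py0.
have ex_y : exists y, P [:: x; k0; y; g k0] by exists y0.
case: (ex_minnP ex_y) => y1 Py1 min_y1; exists y1; last by exists k0.
exists k0, (g k0); split=> // [|i lti].
  rewrite /first_candidate Py1 (leq_trans (min_y1 _ Py0))//=.
  apply/hasPn => z; rewrite mem_iota /= add0n => ltz.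
  by apply: contraL ltz => /min_y1; rewrite leqNgt.
exists (g i) => //; apply: contraLR lti => /min_k0.
by rewrite -leqNgt.
Qed.

Definition in_canonical u i a := odd (u %/ 2 ^ cantor_pair i a).

(** The values of [f] are read from the finite set with index [u]. Its elements are below [u] and
    bound the numbers they encode, so all quantifiers can be bounded by [u]. *)
Definition search_graph (s : seq nat) : bool :=
  let: (x, y, u) := (nth 0 s 0, nth 0 s 1, nth 0 s 2) in
  has (fun k =>
    has (fun a => in_canonical u k a && first_candidate x k a y) (iota 0 u) &&
    all (fun i => has (fun a => in_canonical u i a && no_candidate x i a)
                      (iota 0 u)) (iota 0 k)) (iota 0 u).

Lemma drec_search_graph : drec 3 search_graph.
Proof.
have dP n x k y a : drec n (fun s =>
    P [:: nth 0 s x; nth 0 s k; nth 0 s y; nth 0 s a]).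
  exact: (trec_nths (F := P) n (l := [:: x; k; y; a])).
have din n u i a : drec n (fun s =>
    in_canonical (nth 0 s u) (nth 0 s i) (nth 0 s a)).
  by apply/drec_odd/trec_div_exp2/trec_cantor_pair; apply: trec_nth.
(* Each bounded quantifier puts its variable in front: the list here is [a, k, x, y, u], and for
   [dno] it is [a, i, k, x, y, u]. *)
have dfirst : drec 5 (fun s =>
    first_candidate (nth 0 s 2) (nth 0 s 1) (nth 0 s 0) (nth 0 s 3)).
  apply: drec_and; first by apply: drec_leq; apply: trec_nth.
  apply: drec_and; first exact: dP.
  exact: drec_not (drec_has (trec_nth _ 3) (dP 6 3 2 0 1)).
have dno : drec 6 (fun s =>
    no_candidate (nth 0 s 3) (nth 0 s 1) (nth 0 s 0)).
  exact: drec_not (drec_has (trec_succ (trec_nth _ 1)) (dP 7 4 2 0 1)).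
have d1 := drec_has (trec_nth 4 3) (drec_and (din 5 4 1 0) dfirst).
have d2 := drec_has (trec_nth 5 4) (drec_and (din 6 5 1 0) dno).
exact: drec_has (trec_nth _ 2) (drec_and d1 (drec_all (trec_nth 4 0) d2)).
Qed.

Lemma search_graphP f x y :
  (exists u, search_graph [:: x; y; u] /\ canonical_set u `<=` graph_code f) <->
  search_result f x y.
Proof.
split=> [[u [/hasP[k _ /andP[/hasP[a _ /andP[ka ca]] /allP nc]] uf]]|].
  have in_f i b : in_canonical u i b -> f i = Some b.
    by move=> /uf[i' [b' [/cantor_pair_inj[-> ->]]]].
  exists k, a; split=> // [|i lti]; first exact: in_f.
  have := nc i; rewrite mem_iota => /(_ lti)/hasP[b _ /andP[/in_f fi ni]].
  by exists b.
move=> [k [a [fk ca nc]]].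
have [v vE] : exists v : nat -> nat, forall i, i <= k -> f i = Some (v i).
  exists (fun i => odflt 0 (f i)) => i; rewrite leq_eqVlt => /predU1P[->|].
    by rewrite fk.
  by move=> /nc[b ->].
have vk : v k = a by have := vE _ (leqnn k); rewrite fk => -[].
(* The finite set to be indexed is the graph of [f] restricted to the stages up to [k]. *)
pose codes := [seq cantor_pair i (v i) | i <- iota 0 k.+1].
have [u uE] := canonical_set_bounded (mem codes) (\max_(c <- codes) c).+1.
have uE' c : canonical_set u c <-> c \in codes.
  rewrite uE ltnS; split=> [/andP[]//|cin]; apply/andP; split=> //.
  exact: (@leq_bigmax_seq _ codes xpredT (fun c => c)).
have in_u i : i <= k -> in_canonical u i (v i).
  by move=> lei; apply/uE'/mapP; exists i; rewrite ?mem_iota.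
have bound i : i <= k -> i < u /\ v i < u.
  move=> /in_u/canonical_set_lt ltu.
  by have [] := leq_cantor_pair i (v i); split; apply: leq_ltn_trans ltu.
exists u; split; last first.
  move=> c /uE'/mapP[i]; rewrite mem_iota => lei ->.
  by exists i, (v i); split=> //; apply: vE.
have [ltk lta] := bound k (leqnn k).
apply/hasP; exists k; rewrite ?mem_iota//; apply/andP; split.
  by apply/hasP; exists a; rewrite ?mem_iota -?vk//= in_u//= vk.
apply/allP => i; rewrite mem_iota => /= lti.
have [b fi nb] := nc i lti; have := vE _ (ltnW lti); rewrite fi => -[vi].
have [_ ltv] := bound i (ltnW lti).
apply/hasP; exists (v i); rewrite ?mem_iota// -{2}vi nb andbT.
exact/in_u/ltnW.
Qed.

Lemma recursive_operator_search :
  exists2 T, recursive_operator T &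
    forall f x y, search_result f x y -> T f x = Some y.
Proof.
(* Choice defines the operator as a function; it is recursive because its graph, which is
   single-valued, is given by the decidable [search_graph]. *)
pose T (f : pfun) x := if pselect (exists y, search_result f x y) is left h
  then Some (projT1 (cid h)) else None.
have TE f x y : T f x = Some y <-> search_result f x y.
  rewrite /T; case: pselect => [h|nh]; last first.
    by split=> // fy; case: nh; exists y.
  case: cid => y' /= fy'; split=> [[<-]//|fy].
  by rewrite (search_result_fun fy fy').
exists T => [|f x y /TE//].
exists (fun x => search_graph x); split; first exact/drec_re/drec_search_graph.
by move=> f x y; rewrite TE search_graphP.
Qed.

End Search.

(** * Approximation *)

Lemma param_free_rat (R : realType) (f : ord.formula R) :
  param_free f -> rat_form f.
Proof.
have term_rat (t : GRing.term R) : param_free_term t -> rat_term t.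
  by elim: t => //= t1 IH1 t2 IH2 /andP[/IH1-> /IH2->].
elim: f => //= [t1 t2|t1 t2|t1 t2|f IHf g IHg|f IHf g IHg|f IHf g IHg];
  by [move=> /andP[/term_rat-> /term_rat->]
     |move=> /andP[/IHf-> /IHg->]].
Qed.

Section RatrecFamilies.
Variable n : nat.

Lemma ratrec_num_rat r s t F : recursive r -> recursive s -> recursive t ->
  trec n F -> ratrec n (fun x => num_rat r s t (F x)).
Proof.
move=> rr rs rt rF; exists (fun x => r (F x)), (fun x => s (F x)).
by exists (fun x => t (F x)); split; do ?exact: trec_recursive.
Qed.

Lemma ratrec_exp2V F : trec n F -> ratrec n (fun x => 2 ^- F x).
Proof.
(* The denominator is stored as its predecessor. *)
move=> rF; exists (fun=> 1%N), (fun=> 0%N), (fun x => (2 ^ F x).-1).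
split; do ?exact: trec_const; first exact/trec_pred/trec_exp2.
by move=> s _; rewrite subr0 prednK ?expn_gt0// natrX mul1r.
Qed.

Lemma ratrec_nth_cat E E' k : (forall x, size (E x) = k) ->
  (forall i, ratrec n (fun x => (E x)`_i)) ->
  (forall i, ratrec n (fun x => (E' x)`_i)) ->
  forall i, ratrec n (fun x => (E x ++ E' x)`_i).
Proof.
move=> sz rE rE' i; case: (ltnP i k) => lik.
  by apply: ratrec_ext (rE i) => x _; rewrite nth_cat sz lik.
by apply: ratrec_ext (rE' (i - k)%N) => x _; rewrite nth_cat sz ltnNge lik.
Qed.

End RatrecFamilies.

(** * The approximation condition as a first-order formula *)

Section Approximation.
Variables (R : realType) (N : nat).
Variables (alpha : nat -> 'rV[rat]_N) (beta : nat -> rat).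
Variables (D : set 'rV[R]_N) (theta : 'rV[R]_N -> R).

(** The exponent [x.+1] leaves room for the Cauchy condition: two outputs are compared through the
    exact value, at the cost of two errors. *)
Definition approximates x k y a : Prop :=
  forall z, D z -> max_dist z (real_numbering_rV R alpha a) <= 2 ^- k ->
    abs_dist (theta z) (real_numbering R beta y) <= 2 ^- x.+1.

Lemma max_dist_le (u v : 'rV[R]_N) d : 0 <= d ->
  max_dist u v <= d <-> forall k, `|u ord0 k - v ord0 k| <= d.
Proof.
move=> d0; split=> [/bigmax_leP[_ le_d] k|le_d]; first exact: le_d.
by apply/bigmax_leP; split=> // k _; apply: le_d.
Qed.

Definition dist_form i j d : ord.formula R :=
  let sub i j := GRing.Add (GRing.Var R i) (GRing.Opp (GRing.Var R j)) in
  ord.And (ord.Le (sub i j) (GRing.Var R d)) (ord.Le (sub j i) (GRing.Var R d)).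

Lemma holds_dist_form (e : seq R) i j d :
  ord.holds e (dist_form i j d) <-> `|e`_i - e`_j| <= e`_d.
Proof.
rewrite /= ler_norml lerNl opprB andbC; split=> [[-> ->//]|/andP[]//].
Qed.

Definition coords (z : 'rV[R]_N) : seq R := [seq z ord0 k | k <- enum 'I_N].

Lemma size_coords z : size (coords z) = N.
Proof. by rewrite size_map size_enum_ord. Qed.

Lemma nth_coords z (k : 'I_N) : (coords z)`_k = z ord0 k.
Proof. by rewrite (nth_map k) ?size_enum_ord// nth_ord_enum. Qed.

(** Here [s] is [[:: x; k; y; a]]. The coordinates of the rational point fill positions 0 to
    [N - 1]; the radius, the output and the tolerance follow at [N], [N + 1] and [N + 2]. *)
Definition params (s : seq nat) : seq rat :=
  [seq alpha (nth 0%N s 3) ord0 k | k <- enum 'I_N] ++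
  [:: 2 ^- nth 0%N s 1; beta (nth 0%N s 2); 2 ^- (nth 0%N s 0).+1].

(* The variables of [phi] are among the first [M]; the rational parameters
   are put behind them. *)
Definition approximation_formula (phi : ord.formula R) M : ord.formula R :=
  foldr (@ord.Forall R)
    (ord.Implies
      (ord.And phi (foldr (@ord.And R) (ord.Bool true)
         [seq dist_form k (M + k) (M + N) | k <- iota 0 N]))
      (dist_form N (M + N).+1 (M + N).+2))
    (iota 0 N.+1).

(** The quantified variables overwrite the first [N + 1] of the [M] zeros by the coordinates of a
    point and a value [y]. The premise [phi] forces the point into [D] and [y] to be its image, so
    the quantifier over [y] does no more than name that image. *)
Lemma approximation_formulaP phi M s :
  (N < M)%N ->
  (forall e e' : seq R, (forall i, (i < M)%N -> e`_i = e'`_i) ->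
     ord.holds e phi <-> ord.holds e' phi) ->
  (forall x y, ord.holds (rcons (coords x) y) phi <-> D x /\ y = theta x) ->
  ord.holds (map ratr (nseq M 0 ++ params s)) (approximation_formula phi M) <->
  approximates (nth 0%N s 0) (nth 0%N s 1) (nth 0%N s 2) (nth 0%N s 3).
Proof.
move=> ltNM locM phiP; set e0 := map _ _.
have size_params : size (params s) = N.+3.
  by rewrite size_cat size_map size_enum_ord addn3.
have size_e0 : size e0 = (M + N.+3)%N.
  by rewrite size_map size_cat size_nseq size_params.
pose env z y := rcons (coords z) y ++ drop N.+1 e0.
have nth_env z y i : (N < i)%N -> (env z y)`_i = e0`_i.
  move=> ltNi; rewrite nth_cat size_rcons size_coords ltnNge ltNi /=.
  by rewrite nth_drop subnKC.
have nth_par z y j : (env z y)`_(M + j) = ratr (params s)`_j.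
  rewrite nth_env; last exact: ltn_addr.
  rewrite /e0 map_cat nth_cat size_map size_nseq ltnNge leq_addr /= addKn.
  have [ltj|lej] := ltnP j N.+3; first by rewrite (nth_map 0) ?size_params.
  by rewrite !nth_default ?size_map ?size_params// raddf0.
have nth_z z y (k : 'I_N) : (env z y)`_k = z ord0 k.
  rewrite nth_cat size_rcons size_coords ltnW ?ltnS ?ltn_ord//.
  by rewrite nth_rcons size_coords ltn_ord nth_coords.
have nth_y z y : (env z y)`_N = y.
  rewrite nth_cat size_rcons size_coords ltnSn.
  by rewrite nth_rcons size_coords ltnn eqxx.
(* From position [N + 1] up to [M] the environment holds zeros, which is what [nth] reads beyond the
   end of the shorter list. *)
have phi_env z y : ord.holds (env z y) phi <-> D z /\ y = theta z.
  rewrite -phiP; apply: locM => i ltiM; have [leiN|ltNi] := leqP i N.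
    by rewrite nth_cat size_rcons size_coords ltnS leiN.
  rewrite nth_env// [RHS]nth_default ?size_rcons ?size_coords//.
  rewrite /e0 map_cat nth_cat size_map size_nseq ltiM (nth_map 0) ?size_nseq//.
  by rewrite nth_nseq ltiM raddf0.
have near_env z y : ord.holds (env z y) (foldr (@ord.And R) (ord.Bool true)
    [seq dist_form k (M + k) (M + N) | k <- iota 0 N]) <->
    max_dist z (real_numbering_rV R alpha (nth 0%N s 3)) <= 2 ^- nth 0%N s 1.
  have nth_d : (env z y)`_(M + N) = 2 ^- nth 0%N s 1.
    rewrite nth_par nth_cat size_map size_enum_ord ltnn subnn /=.
    by rewrite fmorphV rmorphXn/= ratr_nat.
  have nth_a (k : 'I_N) : (env z y)`_(M + k) =
      real_numbering_rV R alpha (nth 0%N s 3) ord0 k.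
    rewrite nth_par nth_cat size_map size_enum_ord ltn_ord mxE.
    by rewrite (nth_map k) ?size_enum_ord// nth_ord_enum.
  rewrite max_dist_le ?invr_ge0 ?exprn_ge0// holds_foldr_And size_map size_iota.
  split=> [Hk k|Hk i lti].
    have := Hk k (ltn_ord k).
    rewrite (nth_map 0%N) ?size_iota// nth_iota// holds_dist_form add0n.
    by rewrite nth_z nth_a nth_d.
  rewrite (nth_map 0%N) ?size_iota// nth_iota// holds_dist_form add0n.
  by have := Hk (Ordinal lti); rewrite -nth_a -(nth_z z y) -nth_d.
have close_env z y : ord.holds (env z y)
    (dist_form N (M + N).+1 (M + N).+2) <->
    `|y - real_numbering R beta (nth 0%N s 2)| <= 2 ^- (nth 0%N s 0).+1.
  rewrite holds_dist_form nth_y -!addnS !nth_par !nth_cat.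
  rewrite size_map size_enum_ord !ltnNge !leqW//= !subSnn.
  rewrite (_ : N.+2 - N = 2)%N; last lia.
  by rewrite /= fmorphV rmorphXn/= ratr_nat.
rewrite holds_foldr_Forall; last by rewrite size_e0; lia.
rewrite take0; split=> [Hv z Dz near_z|Hz v size_v].
  apply/(close_env z (theta z)).
  apply: (Hv (rcons (coords z) (theta z))); rewrite ?size_rcons ?size_coords//.
  by split; [apply/phi_env|apply/near_env].
(* Any list of [N + 1] reals consists of the coordinates of a row and one further value. *)
have vE : v = rcons (coords (\row_k v`_k)) v`_N.
  apply: (@eq_from_nth _ 0); rewrite size_v ?size_rcons ?size_coords// => i.
  rewrite ltnS nth_rcons size_coords => leiN.
  case: (ltngtP i N) leiN => // [ltiN _|-> //].
  by rewrite (nth_coords _ (Ordinal ltiN)) mxE.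
rewrite /= add0n {}vE => -[/phi_env[Dz yE] /near_env near_z].
by apply/close_env; rewrite yE; apply: Hz.
Qed.

End Approximation.

(** * Decidability of the condition and correctness of the search *)

Section Computability.
Variables (R : realType) (N : nat).
Variables (alpha : nat -> 'rV[rat]_N) (beta : nat -> rat).
Variables (D : set 'rV[R]_N) (theta : 'rV[R]_N -> R).
Hypothesis halpha : standard_numbering_rV alpha.
Hypothesis hbeta : standard_numbering_rat beta.
Hypothesis theta_sa : strongly_semialgebraic D theta.
Hypothesis theta_cont : {within D, continuous theta}.

Lemma ratrec_params i : ratrec 4 (fun s => (params alpha beta s)`_i).
Proof.
move: i; apply: (@ratrec_nth_cat _ _ _ N) => [s|i|[|[|[|i]]]].
- by rewrite size_map size_enum_ord.
- case: (ltnP i N) => [lti|lei]; last first.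
    apply: ratrec_ext (ratrec_const 4 0) => s _.
    by rewrite nth_default// size_map size_enum_ord.
  have [[r [s [t [/(_ (Ordinal lti))[rr rs rt] alphaE]]]] _] := halpha.
  apply: ratrec_ext (ratrec_num_rat rr rs rt (trec_nth 4 3)) => x _.
  rewrite (nth_map (Ordinal lti)) ?size_enum_ord// alphaE mxE.
  by rewrite -[i]/(val (Ordinal lti)) nth_ord_enum.
- exact/ratrec_exp2V/trec_nth.
- have [[r [s [t [[rr rs rt] betaE]]]] _] := hbeta.
  apply: ratrec_ext (ratrec_num_rat rr rs rt (trec_nth 4 2)) => x _.
  by rewrite /= betaE.
- exact/ratrec_exp2V/trec_succ/trec_nth.
- by apply: ratrec_ext (ratrec_const 4 0) => s _; rewrite /= nth_nil.
Qed.

(** The rational data are free variables of one fixed formula, so quantifiers are eliminated once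
    and the resulting [g] serves for all arguments. *)
Lemma drec_approximates : exists2 P, drec 4 P &
  forall x k y a, P [:: x; k; y; a] <-> approximates alpha beta D theta x k y a.
Proof.
have [phi [rphi /param_free_rat tphi phiP]] := theta_sa.
have [M0 locM0] := holds_local phi.
pose M := maxn M0 N.+1.
have locM (e e' : seq R) : (forall i, (i < M)%N -> e`_i = e'`_i) ->
    ord.holds e phi <-> ord.holds e' phi.
  by move=> ee'; apply: locM0 => i lti; rewrite ee'// leq_max lti.
have ltNM : (N < M)%N by rewrite leq_max leqnn orbT.
pose f := approximation_formula N phi M.
have rf : ord.rformula f && rat_form f.
  rewrite /f /approximation_formula; move: (iota 0 N.+1) => l.
  elim: l => //=; rewrite rphi tphi /= !andbT.
  by elim: (iota 0 N).
have /andP[rf1 rf2] := rf.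
have [g [qg rg tg gP]] := rational_quantifier_elimination rf1 rf2.
exists (fun s => ord.qf_eval (map ratr (nseq M 0 ++ params alpha beta s)) g).
  apply: drec_qf_eval => //; apply: (ratrec_nth_cat (k := M)) => [s|i|].
  - exact: size_nseq.
  - by apply: ratrec_ext (ratrec_const 4 0) => s _; rewrite nth_nseq if_same.
  - exact: ratrec_params.
by move=> x k y a; rewrite -gP; apply: approximation_formulaP ltNM locM phiP.
Qed.

(** Balls of row vectors are taken entry by entry, so a bound on [max_dist] gives membership in the
    ball supplied by continuity. *)
Lemma theta_near (xi : 'rV[R]_N) (eps : R) : D xi -> 0 < eps ->
  exists2 d : R, 0 < d &
    forall z, D z -> max_dist z xi < d -> `|theta z - theta xi| < eps.
Proof.
move=> Dxi eps0; have := (subspace_continuousP D theta).1 theta_cont xi Dxi.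
move=> /cvgrPdist_lt/(_ _ eps0); rewrite near_withinE.
move=> /nbhs_ballP[d d0 near_xi].
exists d => // z Dz zxi; rewrite distrC; apply: near_xi => //.
split=> // i j; rewrite (ord1 i) /ball /= distrC; apply: le_lt_trans zxi.
exact: (le_bigmax_cond _ (fun k => `|z ord0 k - xi ord0 k|)).
Qed.

(** For [i > k] the triangle inequality bounds the distance by [2 ^- k + d (nu (f i)) x]; let [i]
    tend to infinity. *)
Lemma cauchy_name_dist (X : Type) (d : X -> X -> R) (nu : nat -> X) x f k :
  (forall u v w, d u w <= d u v + d v w) ->
  (forall i k, (i < k)%N -> d (nu (f i)) (nu (f k)) <= 2 ^- i) ->
  (fun i => d (nu (f i)) x) @ \oo --> (0 : R) ->
  d (nu (f k)) x <= 2 ^- k.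
Proof.
move=> d_tri d_cauchy d_cvg.
have cvg1 : (fun i => 2 ^- k + d (nu (f i)) x) @ \oo --> (2 ^- k + 0 : R).
  by apply: cvgD => //; apply: cvg_cst.
rewrite -[leRHS]addr0 -(cvg_lim _ cvg1)//; apply: limr_ge.
  by apply/cvg_ex; eexists; exact: cvg1.
near=> i; apply: le_trans (d_tri _ (nu (f i)) _) _; rewrite lerD2r.
by apply: d_cauchy; near: i; apply: nbhs_infty_gt.
Unshelve. all: by end_near. Qed.

Lemma max_dist_triangle (u v w : 'rV[R]_N) :
  max_dist u w <= max_dist u v + max_dist v w.
Proof.
have max_dist_ge0 (a b : 'rV[R]_N) : 0 <= max_dist a b by apply: bigmax_ge_id.
apply/max_dist_le; first by rewrite addr_ge0.
move=> k; apply: le_trans (ler_distD (v ord0 k) _ _) _.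
by apply: lerD; apply: (max_dist_le _ _ (max_dist_ge0 _ _)).1.
Qed.

Lemma max_distC (u v : 'rV[R]_N) : max_dist u v = max_dist v u.
Proof. by apply: eq_bigr => k _; rewrite distrC. Qed.

(** Half of the tolerance goes to the variation of [theta] near [xi], half to the rational
    approximation of [theta xi]. *)
Lemma approximates_name (xi : 'rV[R]_N) (f : nat -> nat) x : D xi ->
  (forall k, max_dist (real_numbering_rV R alpha (f k)) xi <= 2 ^- k) ->
  exists k y, (y <= k)%N /\ approximates alpha beta D theta x k y (f k).
Proof.
move=> Dxi f_xi; pose eps : R := 2 ^- x.+1.
have eps0 : 0 < eps by rewrite invr_gt0 exprn_gt0.
have eps20 : 0 < eps / 2 by rewrite divr_gt0.
have [d d0 near_xi] := theta_near Dxi eps20.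
have [q] : exists q : rat, `|theta xi - ratr q| < eps / 2.
  have lt_q : theta xi - eps / 2 < theta xi + eps / 2 by lra.
  have [q] := rat_in_itvoo lt_q.
  rewrite in_itv /= => /andP[q1 q2]; exists q.
  by rewrite ltr_norml; lra.
have [y <-] := hbeta.2 q => beta_y.
(* The factor 2 accounts for the distances from [z] to the rational point and from there to [xi]. *)
have [k0 k0d] : exists k0, forall k, (k0 <= k)%N -> 2 * 2 ^- k < d.
  have : (fun k => 2 * (2^-1 ^+ k) : R) @ \oo --> (2 * 0 : R).
    by apply: cvgMr; apply: cvg_expr; rewrite ger0_norm; lra.
  rewrite mulr0 => /cvgrPdist_lt/(_ _ d0)[k0 _ k0d]; exists k0 => k /k0d.
  have pow_ge0 : 0 <= 2 * 2^-1 ^+ k :> R by rewrite mulr_ge0// exprn_ge0.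
  by rewrite /= sub0r normrN ger0_norm// exprVn.
(* The stage must be late enough both for the radius to be small and for the index [y] to be
   tried. *)
exists (maxn k0 y), y; split; first exact: leq_maxr.
set k := maxn k0 y => z Dz z_near.
have zxi : max_dist z xi < d.
  have := max_dist_triangle z (real_numbering_rV R alpha (f k)) xi.
  move=> /le_lt_trans; apply; apply: le_lt_trans (lerD z_near (f_xi k)) _.
  by have := k0d k (leq_maxl _ _); rewrite mulr_natl mulr2n.
have := near_xi z Dz zxi; rewrite /abs_dist /real_numbering => z_theta.
apply: le_trans (ler_distD (theta xi) _ _) _.
have -> : 2 ^- x.+1 = eps / 2 + eps / 2 :> R by rewrite -/eps; lra.
by apply/ltW/ltrD.
Qed.

Lemma type2_computable : exists2 T, recursive_operator T &
  forall (xi : 'rV[R]_N) (f : pfun), D xi ->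
    cauchy_name (@max_dist R N) (real_numbering_rV R alpha) xi f ->
    cauchy_name (@abs_dist R) (real_numbering R beta) (theta xi) (T f).
Proof.
have [P dP PE] := drec_approximates.
have [T recT TE] := recursive_operator_search dP.
exists T => // xi F Dxi [f [Ff f_cauchy f_cvg]].
have f_xi k : max_dist (real_numbering_rV R alpha (f k)) xi <= 2 ^- k.
  exact: cauchy_name_dist max_dist_triangle f_cauchy f_cvg.
have /choice[g gP] x : exists y, T F x = Some y /\
    abs_dist (theta xi) (real_numbering R beta y) <= 2 ^- x.+1.
  have [k [y [leyk /PE Py]]] := approximates_name x Dxi f_xi.
  have [|y' /TE TFx [k' /PE]] := search_result_exists Ff (x := x) (P := P).
    by exists k, y.
  move=> near_xi; exists y'; split=> //.
  (* The output is only known to satisfy the condition at its own stage [k']; [xi] lies in the ball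
     of every stage, so it may be taken as [z]. *)
  by apply: near_xi => //; rewrite max_distC.
have half_pow i : 2 ^- i = 2 ^- i.+1 + 2 ^- i.+1 :> R.
  by rewrite exprSr invfM -splitr.
exists g; split=> [i|i k ltik|]; first by have [] := gP i.
  have [_ gi] := gP i; have [_ gk] := gP k.
  (* For [i < k], the errors of both outputs are at most [2 ^- i.+1]. *)
  rewrite half_pow; apply: le_trans (ler_distD (theta xi) _ _) _.
  rewrite [X in X + _]distrC.
  apply: lerD gi _; apply: le_trans gk _.
  by rewrite lef_pV2 ?posrE ?exprn_gt0// ler_weXn2l ?ler1n// leqW.
apply: (@squeeze_cvgr _ _ _ _ (cst 0) (fun k => 2^-1 ^+ k : R)).
- near=> k; rewrite /cst /abs_dist normr_ge0 distrC /=; have [_ gk] := gP k.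
  apply: le_trans gk _; rewrite -exprVn.
  by rewrite exprSr ler_piMr ?exprn_ge0 ?invr_ge0// invf_le1// ler1n.
- exact: cvg_cst.
- by apply: cvg_expr; rewrite ger0_norm; lra.
Unshelve. all: by end_near. Qed.

End Computability.

Theorem theorem4 (R : realType) (N : nat) (hN : (1 <= N)%N)
    (alpha : nat -> 'rV[rat]_N) (halpha : standard_numbering_rV alpha)
    (beta : nat -> rat) (hbeta : standard_numbering_rat beta)
    (D : set 'rV[R]_N) (theta : 'rV[R]_N -> R)
    (theta_cont : {within D, continuous theta})
    (theta_sa : strongly_semialgebraic D theta) :
  exists T : pfun -> pfun,
    recursive_operator T /\
    forall (xi : 'rV[R]_N) (f : pfun),
      D xi ->
      cauchy_name (@max_dist R N) (real_numbering_rV R alpha) xi f ->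
      cauchy_name (@abs_dist R) (real_numbering R beta) (theta xi) (T f).
Proof.
have [T recT TP] := type2_computable halpha hbeta theta_sa theta_cont.
by exists T.
Qed.
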